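(* Let $n\geq 2$ and let $K\subset\mathbb{R}^n$ be a convex body with $\mathrm{r}_{n-1}(K)>0$. Then \[ \frac{\mathrm{R}_2(K)}{\mathrm{r}_{n-1}(K)}\leq 2\sqrt{2}\sqrt{n}. \]
   Context: A convex body is a compact convex subset of $\mathbb{R}^n$. For $1\le i\le n$, let $\mathcal{L}^n_i$ be the set of $i$-dimensional linear subspaces of $\mathbb{R}^n$, $K|L$ the orthogonal projection of $K$ onto $L$, $L^\perp$ the orthogonal complement. For a set $C$ contained in an affine subspace $A$, $\mathrm{R}(C;A)$ and $\mathrm{r}(C;A)$ denote the Euclidean circumradius and inradius of $C$ measured within $A$. Define $\mathrm{R}_i(K)=\min_{L\in\mathcal{L}^n_i}\mathrm{R}(K|L;L)$ and $\mathrm{r}_i(K)=\max_{L\in\mathcal{L}^n_i}\max_{x\in L^\perp}\mathrm{r}(K\cap(x+L);x+L)$. *)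

(* Defs.v *)
From HB Require Import structures.
From mathcomp Require Import all_boot all_order all_algebra.
From mathcomp Require Import all_classical all_reals all_analysis.
Set Implicit Arguments. Unset Strict Implicit. Unset Printing Implicit Defensive.
Import Order.TTheory GRing.Theory Num.Theory.
Import numFieldNormedType.Exports.
Local Open Scope classical_set_scope.
Local Open Scope ring_scope.

Section Defs.
Variables (R : realType) (n : nat).
Local Notation V := 'rV[R]_n.

Definition dotv (u v : V) : R := \sum_(i < n) u 0 i * v 0 i.
Definition enorm (u : V) : R := Num.sqrt (dotv u u).

Definition eball (c : V) (r : R) : set V := [set y | enorm (y - c) <= r].

Definition convex_set (K : set V) : Prop :=
  forall x y, K x -> K y -> forall t : R, 0 <= t <= 1 -> K (t *: x + (1 - t) *: y).

Definition convex_body (K : set V) : Prop :=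
  K !=set0 /\ compact K /\ convex_set K.

(* a linear subspace is given as the row space of a square matrix L *)
Definition subsp (L : 'M[R]_n) : set V := [set v | (v <= L)%MS].
Definition orthc (L : 'M[R]_n) : set V :=
  [set y | forall v, subsp L v -> dotv y v = 0].
Definition affsp (x : V) (L : 'M[R]_n) : set V := [set x + v | v in subsp L].

Definition oproj (K : set V) (L : 'M[R]_n) : set V :=
  [set p | exists2 x, K x & subsp L p /\ orthc L (x - p)].

Definition circumradius (C A : set V) : R :=
  inf [set r | 0 <= r /\ exists2 c, A c & C `<=` eball c r].

Definition inradius (C A : set V) : R :=
  sup [set r | 0 <= r /\ exists2 c, A c & eball c r `&` A `<=` C].

Definition Rcirc (i : nat) (K : set V) : R :=
  inf [set r | exists L : 'M[R]_n, \rank L = i /\ r = circumradius (oproj K L) (subsp L)].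

Definition rin (i : nat) (K : set V) : R :=
  sup [set r | exists L : 'M[R]_n, \rank L = i /\
        exists2 x, orthc L x & r = inradius (K `&` affsp x L) (affsp x L)].
End Defs.

(* Main.v *)
Require Import Defs.
From HB Require Import structures.
From mathcomp Require Import all_boot all_order all_algebra.
From mathcomp Require Import all_classical all_reals all_analysis.
From mathcomp Require Import ring lra.
Set Implicit Arguments. Unset Strict Implicit. Unset Printing Implicit Defensive.
Import Order.TTheory GRing.Theory Num.Theory.
Import numFieldNormedType.Exports.
Local Open Scope classical_set_scope.
Local Open Scope ring_scope.

(** Let [h] be the support function of [K] and [u] a unit direction of minimal
    width [w].  The difference body contains the ball of radius [w], so [K] has
    a chord of length [w] parallel to [u], spanning the whole slab of width [w].
    If the projection of [K] to the hyperplane [u^perp] contains a ball of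
    radius [r], then averaging its lift with this chord puts a ball of radius
    [r / 2] in the middle section of the slab.  Hence for [r > 2 r_{n-1}(K)] no
    such ball exists, and separation together with Caratheodory's theorem yields
    [n] vectors [p_i] in [u^perp] with [sum p_i = 0], [sum |p_i| = 1] and
    [sum h(p_i) <= r].  As in Steinhagen's theorem, signs [e_i] can be chosen
    with [|sum e_i p_i|^2 >= sum |p_i|^2 >= 1/n], and [K] has width at most
    [2 r sqrt n] in the direction [v] of [sum e_i p_i].  By minimality the same
    bound holds for [w], so the projection of [K] to [span(u, v)] lies in a
    square of side [2 r sqrt n]. *)

(** * Inner product, compactness and separation in Euclidean space *)

Section Euclidean.
Variables (R : realType) (n : nat).
Implicit Types (u v x y z : 'rV[R]_n) (t : R).

Lemma dotvC x y : dotv x y = dotv y x.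
Proof. by apply: eq_bigr => i _; rewrite mulrC. Qed.

Lemma dotvDl x y z : dotv (x + y) z = dotv x z + dotv y z.
Proof. by rewrite -big_split; apply: eq_bigr => i _; rewrite mxE mulrDl. Qed.

Lemma dotvZl t x y : dotv (t *: x) y = t * dotv x y.
Proof. by rewrite mulr_sumr; apply: eq_bigr => i _; rewrite mxE mulrA. Qed.

Lemma dotvNl x y : dotv (- x) y = - dotv x y.
Proof. by rewrite -scaleN1r dotvZl mulN1r. Qed.

Lemma dotvBl x y z : dotv (x - y) z = dotv x z - dotv y z.
Proof. by rewrite dotvDl dotvNl. Qed.

Lemma dot0v x : dotv 0 x = 0.
Proof. by rewrite -(scale0r 0) dotvZl mul0r. Qed.

Lemma dotvDr x y z : dotv x (y + z) = dotv x y + dotv x z.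
Proof. by rewrite !(dotvC x) dotvDl. Qed.

Lemma dotvZr t x y : dotv x (t *: y) = t * dotv x y.
Proof. by rewrite !(dotvC x) dotvZl. Qed.

Lemma dotvNr x y : dotv x (- y) = - dotv x y.
Proof. by rewrite !(dotvC x) dotvNl. Qed.

Lemma dotvBr x y z : dotv x (y - z) = dotv x y - dotv x z.
Proof. by rewrite dotvDr dotvNr. Qed.

Lemma dotv0 x : dotv x 0 = 0.
Proof. by rewrite dotvC dot0v. Qed.

Lemma dotv_sumr (I : finType) x (f : I -> 'rV[R]_n) :
  dotv x (\sum_i f i) = \sum_i dotv x (f i).
Proof.
by apply: (big_morph (dotv x)); [exact: dotvDr | exact: dotv0].
Qed.

Lemma dotvv_ge0 x : 0 <= dotv x x.
Proof. by apply: sumr_ge0 => i _; rewrite -expr2 sqr_ge0. Qed.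

Lemma dotvv_eq0 x : dotv x x = 0 -> x = 0.
Proof.
move=> /eqP; rewrite psumr_eq0; last by move=> i _; rewrite -expr2 sqr_ge0.
move=> /allP x0; apply/rowP => i; rewrite mxE.
by have /= := x0 i (mem_index_enum i); rewrite mulf_eq0 orbb => /eqP.
Qed.

Lemma enorm_ge0 x : 0 <= enorm x.
Proof. exact: sqrtr_ge0. Qed.

Lemma enorm_sqr x : enorm x ^+ 2 = dotv x x.
Proof. by rewrite sqr_sqrtr // dotvv_ge0. Qed.

Lemma enorm_eq0 x : enorm x = 0 -> x = 0.
Proof. by move=> x0; apply: dotvv_eq0; rewrite -enorm_sqr x0 expr0n. Qed.

Lemma enorm0 : enorm (0 : 'rV[R]_n) = 0.
Proof. by rewrite /enorm dot0v sqrtr0. Qed.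

Lemma enormZ t x : enorm (t *: x) = `|t| * enorm x.
Proof.
by rewrite /enorm dotvZl dotvZr mulrA -expr2 sqrtrM ?sqr_ge0 // sqrtr_sqr.
Qed.

Lemma enormN x : enorm (- x) = enorm x.
Proof. by rewrite -scaleN1r enormZ normrN1 mul1r. Qed.

Lemma enorm_le x t : 0 <= t -> (enorm x <= t) = (dotv x x <= t ^+ 2).
Proof. by move=> t0; rewrite -enorm_sqr ler_sqr // nnegrE enorm_ge0. Qed.

Lemma enorm_unit x : enorm x = 1 <-> dotv x x = 1.
Proof.
split=> [x1|]; first by rewrite -enorm_sqr x1 expr1n.
by rewrite /enorm => ->; rewrite sqrtr1.
Qed.

Lemma enorm_normalize x : x != 0 -> enorm ((enorm x)^-1 *: x) = 1.
Proof.
move=> x0; rewrite enormZ ger0_norm ?invr_ge0 ?enorm_ge0 // mulVf //.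
by apply: contra x0 => /eqP /enorm_eq0 ->.
Qed.

(** Cauchy-Schwarz, from expanding the square of [|y| x - |x| y] and dividing by [2 |x| |y|]. *)
Lemma dotv_le_enorm x y : dotv x y <= enorm x * enorm y.
Proof.
have [->|x0] := eqVneq x 0; first by rewrite dot0v mulr_ge0 ?enorm_ge0.
have nx0 : 0 < enorm x.
  rewrite lt0r enorm_ge0 andbT; apply: contra x0 => /eqP /enorm_eq0 ->.
  exact: eqxx.
have := dotvv_ge0 (enorm y *: x - enorm x *: y).
have [->|y0] := eqVneq y 0; first by rewrite dotv0 mulr_ge0 ?enorm_ge0.
have ny0 : 0 < enorm y.
  rewrite lt0r enorm_ge0 andbT; apply: contra y0 => /eqP /enorm_eq0 ->.
  exact: eqxx.
rewrite dotvBl !dotvBr !dotvZl !dotvZr -!enorm_sqr (dotvC y x) => h.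
rewrite -(ler_pM2l (mulr_gt0 nx0 ny0)).
move: h; set a := enorm x; set b := enorm y; set d := dotv x y => h.
have -> : a * b * (a * b) = a ^+ 2 * b ^+ 2 by ring.
nra.
Qed.

Lemma coord_le_enorm x i : `|x 0 i| <= enorm x.
Proof.
rewrite -ler_sqr ?nnegrE ?enorm_ge0 // enorm_sqr real_normK ?num_real //.
rewrite /dotv (bigD1 i) //= -expr2 lerDl.
by apply: sumr_ge0 => j _; rewrite -expr2 sqr_ge0.
Qed.

Lemma continuous_sum (T : topologicalType) (V : normedModType R) (m : nat)
    (f : 'I_m -> T -> V) :
  (forall i, continuous (f i)) -> continuous (fun s => \sum_(i < m) f i s).
Proof.
move=> fc; have -> : (fun s => \sum_(i < m) f i s) = \sum_(i < m) f i.
  by apply/funext => s; rewrite fct_sumE.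
apply: (big_ind (fun g : T -> V => continuous g)) => [|g h gc hc|i _]; first exact: cst_continuous.
  by move=> s; apply: continuousD; [exact: gc|exact: hc].
exact: fc.
Qed.

Lemma continuous_mx (T : topologicalType) (m p : nat) (f : T -> 'M[R]_(m, p)) :
  (forall i j, continuous (fun s => f s i j)) -> continuous f.
Proof.
move=> fc s A [P Ps PA].
apply: (@filterS _ _ _ [set q | forall i j, P i j (f q i j)]).
  by move=> q; apply: (PA (f q)).
apply: filter_forall => i; apply: filter_forall => j; exact: fc (Ps i j).
Qed.

Lemma continuous_dotv (T : topologicalType) (f g : T -> 'rV[R]_n) :
  continuous f -> continuous g -> continuous (fun s => dotv (f s) (g s)).
Proof.
move=> fc gc; apply: continuous_sum => i s; apply: continuousM.
  exact: (@continuous_comp _ _ _ f (fun M : 'rV[R]_n => M 0 i) s (fc s)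
    (@coord_continuous _ _ _ 0 i (f s))).
exact: (@continuous_comp _ _ _ g (fun M : 'rV[R]_n => M 0 i) s (gc s)
    (@coord_continuous _ _ _ 0 i (g s))).
Qed.

Lemma continuous_enorm : continuous (@enorm R n).
Proof.
move=> x; apply: (@continuous_comp _ _ _ (fun x => dotv x x) Num.sqrt).
  by apply: continuous_dotv => ?; exact: cvg_id.
exact: sqrt_continuous.
Qed.

Lemma closed_eq_cst (T : topologicalType) (f : T -> R) (a : R) :
  continuous f -> closed [set s | f s = a].
Proof.
move=> fc; apply: (@preimage_closed _ _ f [set a]) => [s _|].
  exact: fc.
exact: closed_eq.
Qed.

Lemma compact_box (m : nat) (A : set 'rV[R]_m) :
  closed A -> (forall x : 'rV[R]_m, A x -> forall i, `|x 0 i| <= 1) -> compact A.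
Proof.
move=> Acl Ab.
have boxc : compact [set v : 'rV[R]_m | forall i, v ord0 i \in `[(-1 : R), 1]].
  apply: (@rV_compact R m (fun=> `[(-1 : R), 1]%classic)) => _.
  exact: segment_compact.
apply: (subclosed_compact Acl boxc) => x /Ab xb i.
by rewrite in_itv /= -ler_norml.
Qed.

Lemma compact_min (T : topologicalType) (f : T -> R) (A : set T) :
  A !=set0 -> compact A -> continuous f ->
  exists2 a, A a & forall x : T, A x -> f a <= f x.
Proof.
move=> A0 Ac fc; have := compact_EVT_min A0 Ac (continuous_subspaceT fc).
move=> [a /set_mem Aa amin]; exists a => // x Ax.
by apply: amin; exact: mem_set.
Qed.

Lemma compact_enorm_bounded (K : set 'rV[R]_n) :
  compact K -> exists M, forall x, K x -> enorm x <= M.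
Proof.
move=> Kc; have [K0|K0] := pselect (K !=set0); last first.
  by exists 0 => x Kx; case: K0; exists x.
have [|a _ amin] := @compact_min _ (fun x => - enorm x) _ K0 Kc.
  by move=> x; apply: (@continuousN _ _ _ (@enorm R n)); exact: continuous_enorm.
by exists (enorm a) => x /amin; rewrite lerN2.
Qed.

(** First-order optimality condition: the quadratic on the right has value [A] and derivative
    [2 (B - A)] at [e = 0], and it never drops below [A] on the unit interval. It serves for nearest
    points and for the penalty minimised below. *)
Lemma quad_min_le (A B C : R) :
  (forall e, 0 <= e <= 1 ->
    A <= (1 - e) ^+ 2 * A + 2 * e * (1 - e) * B + e ^+ 2 * C) -> A <= B.
Proof.
move=> h; rewrite leNgt; apply/negP => BA.
have [C0|C0] := lerP (A - 2 * B + C) 0.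
  by have := h 1; rewrite ler01 lexx => /(_ isT); lra.
(* The quadratic equals [A - 2 e (A - B) + e^2 (A - 2 B + C)]; this [e] makes the last term at most
   [e (A - B)], so the value falls below [A]. *)
pose e := Num.min 1 ((A - B) / (A - 2 * B + C)).
have e0 : 0 < e by rewrite lt_min ltr01 divr_gt0 //; lra.
have e1 : e <= 1 by rewrite ge_min lexx.
have eC : e * (A - 2 * B + C) <= A - B.
  by rewrite -ler_pdivlMr // ge_min lexx orbT.
have := h e; rewrite (ltW e0) e1 => /(_ isT); nra.
Qed.

(** The normal is the normalised vector from the nearest point [p] of [C] to [y]; moving from [p]
    towards [x] cannot bring it closer to [y]. The explicit form of [z] is kept so that its
    orthogonality to a given vector can be read off later. *)
Lemma strict_separation (C : set 'rV[R]_n) y :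
  C !=set0 -> compact C -> Defs.convex_set C -> ~ C y ->
  exists z, enorm z = 1 /\ (forall x, C x -> dotv x z < dotv y z) /\
            (exists2 p, C p & z = (enorm (y - p))^-1 *: (y - p)).
Proof.
move=> C0 Cc Ccv yC.
have [|p Cp pmin] := @compact_min _ (fun x => dotv (y - x) (y - x)) _ C0 Cc.
  have subc : continuous (fun x : 'rV[R]_n => y - x).
    move=> x; apply: (@continuousB _ _ _ (cst y) id x).
      exact: cst_continuous.
    exact: cvg_id.
  exact: continuous_dotv.
have yp0 : y - p != 0.
  by rewrite subr_eq0; apply/eqP => yp; apply: yC; rewrite yp.
have npos : 0 < enorm (y - p).
  by rewrite lt0r enorm_ge0 andbT; apply: contra yp0 => /eqP /enorm_eq0 ->.
exists ((enorm (y - p))^-1 *: (y - p)); split; first exact: enorm_normalize.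
split; last by exists p.
move=> x Cx; rewrite !dotvZr ltr_pM2l ?invr_gt0 //.
have A0 : 0 < dotv (y - p) (y - p) by rewrite -enorm_sqr exprn_gt0.
suff : dotv (y - p) (y - p) <= dotv (y - p) (y - x).
  rewrite dotvBr -(dotvC y) -(dotvC x) -subr_ge0 -subr_gt0.
  move: A0; rewrite dotvBr (dotvC _ y) (dotvC _ p) dotvBr; lra.
apply: (@quad_min_le _ _ (dotv (y - x) (y - x))) => e e01.
have e01' : 0 <= 1 - e <= 1 by lra.
have := pmin _ (Ccv _ _ Cp Cx _ e01').
have -> : y - ((1 - e) *: p + (1 - (1 - e)) *: x) =
          (1 - e) *: (y - p) + e *: (y - x).
  by apply/rowP => i; rewrite !mxE; ring.
move=> h; apply: (le_trans h).
move: (y - p) (y - x) => a b.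
rewrite !(dotvDl, dotvDr) !(dotvZl, dotvZr) (dotvC b a).
by rewrite le_eqVlt; apply/orP; left; apply/eqP; ring.
Qed.

End Euclidean.

(** * Balanced vectors orthogonal to [u], by Caratheodory reduction and minimisation *)

Section Certificate.
Variables (R : realType) (n : nat).
Variables (h : 'rV[R]_n -> R) (u : 'rV[R]_n).
Hypothesis h_cont : continuous h.
Hypothesis h_scale : forall (t : R) v, 0 <= t -> h (t *: v) <= t * h v.
Hypothesis u_unit : dotv u u = 1.

Lemma h_zero_ge0 : 0 <= h 0.
Proof.
have := @h_scale 2 0 (ler0n _ 2); rewrite scaler0; lra.
Qed.

Lemma drop_zero_vector (p : 'I_n.+1 -> 'rV[R]_n) (i0 : 'I_n.+1) :
  (forall i, dotv (p i) u = 0) -> p i0 = 0 ->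
  exists q : 'I_n -> 'rV[R]_n,
    [/\ forall i, dotv (q i) u = 0,
        \sum_i q i = \sum_i p i,
        \sum_i enorm (q i) = \sum_i enorm (p i) &
        \sum_i h (q i) <= \sum_i h (p i)].
Proof.
move=> pu p0; exists (fun i => p (lift i0 i)); split => [i|||].
- exact: pu.
- by rewrite [RHS](bigD1_ord i0) //= p0 add0r.
- by rewrite [RHS](bigD1_ord i0) //= p0 enorm0 add0r.
- by rewrite [leRHS](bigD1_ord i0) //= p0 lerDr h_zero_ge0.
Qed.

(* The vectors [p i + |p i| u] are [n.+1] in dimension [n]; a linear dependency
   among them preserves both the sum and the total length. *)
Lemma caratheodory_step (p : 'I_n.+1 -> 'rV[R]_n) :
  (forall i, dotv (p i) u = 0) ->
  exists q : 'I_n -> 'rV[R]_n,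
    [/\ forall i, dotv (q i) u = 0,
        \sum_i q i = \sum_i p i,
        \sum_i enorm (q i) = \sum_i enorm (p i) &
        \sum_i h (q i) <= \sum_i h (p i)].
Proof.
move=> pu; have [[i0 p0]|pn0] := pselect (exists i0, p i0 = 0).
  exact: (drop_zero_vector pu p0).
have np i : 0 < enorm (p i).
  rewrite lt0r enorm_ge0 andbT; apply/eqP => /enorm_eq0 pi0.
  by apply: pn0; exists i.
have [a [a0 ap ae ah]] : exists a : 'I_n.+1 -> R,
    [/\ exists i, a i != 0, \sum_i a i *: p i = 0,
        \sum_i a i * enorm (p i) = 0 & \sum_i a i * h (p i) <= 0].
  pose A := \matrix_i (p i + enorm (p i) *: u) : 'M[R]_(n.+1, n).
  have : kermx A != 0.
    rewrite kermx_eq0 -row_leq_rank -ltnNge ltnS; exact: rank_leq_col.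
  case/rowV0Pn => a /sub_kermxP aA a0.
  have e1 : \sum_i a 0 i *: (p i + enorm (p i) *: u) = 0.
    rewrite -[RHS]aA mulmx_sum_row; apply: eq_bigr => i _.
    by rewrite rowK.
  have e2 : \sum_i a 0 i * enorm (p i) = 0.
    have := congr1 (dotv u) e1; rewrite dotv0 dotv_sumr => e.
    rewrite -[RHS]e; apply: eq_bigr => i _.
    by rewrite dotvZr dotvDr dotvZr u_unit (dotvC u) pu add0r mulr1.
  have e3 : \sum_i a 0 i *: p i = 0.
    rewrite -[RHS]e1; under [RHS]eq_bigr do rewrite scalerDr scalerA.
    by rewrite big_split /= -scaler_suml e2 scale0r addr0.
  have [j aj] : exists j, a 0 j != 0.
    apply: contrapT => aj; case/negP: a0; apply/eqP/rowP => j; rewrite mxE.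
    by apply/eqP/negPn/negP => ajn; apply: aj; exists j.
  (* A dependency may be negated, so the sign of its pairing with [h] is free to choose. *)
  have [ah|ah] := lerP (\sum_i a 0 i * h (p i)) 0.
    by exists (fun i => a 0 i); split => //; exists j.
  exists (fun i => - a 0 i); split.
  - by exists j; rewrite oppr_eq0.
  - by under eq_bigr do rewrite scaleNr; rewrite sumrN e3 oppr0.
  - by under eq_bigr do rewrite mulNr; rewrite sumrN e2 oppr0.
  - by under eq_bigr do rewrite mulNr; rewrite sumrN oppr_le0 ltW.
(* Subtracting the dependency divided by its smallest coefficient, which is negative, keeps every
   factor nonnegative and makes the factor at [i0] vanish. *)
pose i0 := [arg min_(i < ord0) a i]%O.
have i0min i : a i0 <= a i.
  by rewrite /i0; case: arg_minP => // j _ jmin; exact: jmin.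
(* Otherwise all coefficients are nonnegative, and the vanishing sum against the positive lengths
   forces them all to be zero. *)
have ai0 : a i0 < 0.
  rewrite ltNge; apply/negP => ai0; case: a0 => j /eqP; apply.
  have ag i : 0 <= a i := le_trans ai0 (i0min i).
  have /eqP := ae; rewrite psumr_eq0; last first.
    by move=> i _; rewrite mulr_ge0 // ltW.
  move=> /allP /(_ j (mem_index_enum j)) /=.
  by rewrite mulf_eq0 (gt_eqF (np j)) orbF => /eqP.
pose s i := 1 - a i / a i0.
have s0 i : 0 <= s i by rewrite subr_ge0 ler_ndivrMr // mul1r.
have [||q [qu qs qe qh]] := @drop_zero_vector (fun i => s i *: p i) i0.
- by move=> i; rewrite dotvZl pu mulr0.
- by rewrite /s divff ?lt_eqF // subrr scale0r.
exists q; split => //.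
- rewrite qs; under eq_bigr do rewrite scalerBl scale1r mulrC -scalerA.
  by rewrite sumrB -scaler_sumr ap scaler0 subr0.
- rewrite qe; under eq_bigr do
    rewrite enormZ ger0_norm // mulrBl mul1r [_ / _]mulrC -mulrA.
  by rewrite sumrB -mulr_sumr ae mulr0 subr0.
- apply: (le_trans qh); apply: (@le_trans _ _ (\sum_i s i * h (p i))).
    by apply: ler_sum => i _; exact: h_scale.
  under eq_bigr do rewrite mulrBl mul1r [_ / _]mulrC -mulrA.
  by rewrite sumrB -mulr_sumr gerBl mulr_le0 // invr_le0 ltW.
Qed.

(** Among [n]-tuples in the hyperplane with total length 1, minimise
    [|sum p_i|^2 + max(0, sum h(p_i) - r)^2]. If the minimum were positive, mixing in a small
    multiple of a suitable [v] would decrease it; [caratheodory_step] brings the resulting [n.+1]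
    vectors back to [n]. *)
Lemma balanced_directions (r : R) :
  (forall c : 'rV[R]_n, exists v,
      [/\ enorm v = 1, dotv v u = 0 & h v < r + dotv c v]) ->
  exists p : 'I_n -> 'rV[R]_n,
    [/\ forall i, dotv (p i) u = 0, \sum_i p i = 0,
        \sum_i enorm (p i) = 1 & \sum_i h (p i) <= r].
Proof.
move=> hr.
(* Tuples are encoded as flattened square matrices, so that compactness of a box of row vectors
   applies. *)
pose P (q : 'rV[R]_(n * n)) i : 'rV[R]_n := row i (vec_mx q).
have Pc i : continuous (P ^~ i).
  apply: continuous_mx => k j.
  have -> : (fun q => P q i k j) = (fun q => q 0 (mxvec_index i j)).
    by apply/funext => q; rewrite /P !mxE.
  exact: coord_continuous.
pose C := [set q | (forall i, dotv (P q i) u = 0) /\ \sum_i enorm (P q i) = 1].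
have Ccompact : compact C.
  apply: compact_box => [|q [_ qe] k].
    have -> : C = (\bigcap_(i in [set: 'I_n]) [set q | dotv (P q i) u = 0]) `&`
                  [set q | \sum_i enorm (P q i) = 1].
      apply/seteqP; split => q [h1 h2]; split => // i; first by move=> _.
      exact: h1.
    apply: closedI.
      apply: closed_bigI => i _; apply: closed_eq_cst.
      by apply: continuous_dotv => //; exact: cst_continuous.
    apply: closed_eq_cst; apply: continuous_sum => i q.
    exact: (continuous_comp (Pc i q) (@continuous_enorm _ _ _)).
  case/mxvec_indexP: k => i j; rewrite -qe (bigD1 i) //=.
  have -> : q 0 (mxvec_index i j) = P q i 0 j by rewrite /P !mxE.
  rewrite ler_wpDr ?coord_le_enorm //.
  by apply: sumr_ge0 => k _; exact: enorm_ge0.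
have CP (p : 'I_n -> 'rV[R]_n) : (forall i, dotv (p i) u = 0) ->
    \sum_i enorm (p i) = 1 -> exists2 q, C q & forall i, P q i = p i.
  move=> pu pe; exists (mxvec (\matrix_i p i)).
    by split=> [i|]; last rewrite -pe; first rewrite -(pu i);
      [|apply: eq_bigr => i _]; rewrite /P mxvecK rowK.
  by move=> i; rewrite /P mxvecK rowK.
have n0 : n%:R != 0 :> R.
  rewrite pnatr_eq0; apply/eqP => n0; move: u_unit; rewrite /dotv big1 => [|i].
    by move/eqP; rewrite eq_sym oner_eq0.
  by move: (ltn_ord i); rewrite {2}n0.
have C0 : C !=set0.
  have [v [v1 vu _]] := hr 0.
  have [||q Cq _] := CP (fun=> n%:R^-1 *: v); last by exists q.
    by move=> i; rewrite dotvZl vu mulr0.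
  rewrite sumr_const card_ord enormZ v1 mulr1 ger0_norm ?invr_ge0 //.
  by rewrite -[_ *+ n]mulr_natr mulVf.
pose Y q := \sum_i P q i.
pose T q := Num.max 0 (\sum_i h (P q i) - r).
have [|q [qu qe] qmin] :=
    @compact_min _ _ (fun q => dotv (Y q) (Y q) + T q ^+ 2) _ C0 Ccompact.
  have Yc : continuous Y by exact: continuous_sum.
  have Tc : continuous T.
    have sc : continuous (fun q => \sum_i h (P q i) - r).
      move=> q; apply: (@continuousB _ _ _ _ (cst r) q); last exact: cst_continuous.
      apply: continuous_sum => i {}q.
      exact: (continuous_comp (Pc i q) (@h_cont _)).
    move=> q; apply: (@continuous_max _ _ (cst 0) _ q); last exact: sc.
    exact: cst_continuous.
  move=> q; apply: (@continuousD _ _ _ (fun q => dotv (Y q) (Y q))).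
    exact: continuous_dotv.
  exact: (@continuousM _ _ T T q (Tc q) (Tc q)).
set y := Y q in qmin; set t := T q in qmin.
have t0 : 0 <= t by rewrite le_max lexx.
(* Optimality of [q] under the perturbation that shrinks the tuple by [1 - e] and adjoins [e v],
   which keeps the total length equal to 1. *)
have key v : enorm v = 1 -> dotv v u = 0 ->
    dotv y y + t ^+ 2 <= dotv y v + t * (h v - r).
  move=> v1 vu; apply: (@quad_min_le _ _ _ (dotv v v + (h v - r) ^+ 2)) => e e01.
  have [e0 e1] := andP e01.
  pose p i := if unlift ord0 i is Some j then (1 - e) *: P q j else e *: v.
  have p0 : p ord0 = e *: v by rewrite /p unlift_none.
  have pS j : p (lift ord0 j) = (1 - e) *: P q j by rewrite /p liftK.
  have [|p' [p'u p's p'e p'h]] := @caratheodory_step p.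
    move=> i; rewrite /p; case: unliftP => [j _|_]; rewrite dotvZl ?qu ?vu mulr0 //.
  have [||q' Cq' q'E] := CP p' => //.
    rewrite p'e big_ord_recl p0 enormZ v1 mulr1 ger0_norm //.
    under eq_bigr do rewrite pS enormZ ger0_norm ?subr_ge0 //.
    by rewrite -mulr_sumr qe mulr1 addrC subrK.
  have Yq' : Y q' = (1 - e) *: y + e *: v.
    rewrite /Y (eq_bigr _ (fun i _ => q'E i)) p's big_ord_recl p0 addrC.
    by under eq_bigr do rewrite pS; rewrite -scaler_sumr.
  (* The absolute value dominates the truncated excess whatever the sign of the expression, and it
     disappears on squaring. *)
  have Tq' : T q' <= `|(1 - e) * t + e * (h v - r)|.
    rewrite ge_max normr_ge0 /=; apply: le_trans (ler_norm _).
    rewrite (eq_bigr _ (fun i _ => congr1 h (q'E i))).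
    have tq : \sum_i h (P q i) - r <= t by rewrite le_max lexx orbT.
    have : \sum_i h (p' i) <= e * h v + (1 - e) * \sum_i h (P q i).
      apply: (le_trans p'h); rewrite big_ord_recl p0; apply: lerD.
        exact: h_scale.
      rewrite mulr_sumr; apply: ler_sum => i _; rewrite pS; apply: h_scale.
      by rewrite subr_ge0.
    have : (1 - e) * (\sum_i h (P q i) - r) <= (1 - e) * t.
      by rewrite ler_wpM2l // subr_ge0.
    lra.
  apply: (le_trans (qmin _ Cq')).
  have Tq'0 : 0 <= T q' by rewrite le_max lexx.
  have : T q' ^+ 2 <= ((1 - e) * t + e * (h v - r)) ^+ 2.
    by rewrite -[leRHS]real_normK ?num_real // ler_sqr ?nnegrE.
  rewrite Yq' !(dotvDl, dotvDr) !(dotvZl, dotvZr) (dotvC v y).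
  move: (T q') => T'; lra.
have yt0 : dotv y y + t ^+ 2 <= 0.
  rewrite leNgt; apply/negP => yt.
  (* Without excess, [key] at [v] and at [- v] gives [y.y <= 0]. With [t > 0], the hypothesis at
     [c = - y / t] gives a [v] for which the right side of [key] is negative. *)
  have [t00|tn0] := eqVneq t 0.
    have [v [v1 vu _]] := hr 0.
    have := key v v1 vu; have := key (- v).
    rewrite enormN dotvNl vu oppr0 dotvNr => /(_ v1 erefl).
    by move: yt; rewrite t00 expr0n /= !mul0r; lra.
  have tp : 0 < t by rewrite lt0r tn0.
  have [v [v1 vu hv]] := hr (- t^-1 *: y).
  have := key v v1 vu; move: hv; rewrite dotvZl -(ltr_pM2l tp) mulrDr.
  rewrite mulrA mulrN divff // mulN1r; lra.
have y0 : y = 0.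
  apply: dotvv_eq0; apply/eqP; rewrite eq_le dotvv_ge0 andbT.
  by have := sqr_ge0 t; lra.
have tz : t = 0.
  apply/eqP; rewrite -sqrf_eq0 eq_le sqr_ge0 andbT.
  by have := dotvv_ge0 y; lra.
exists (P q); split => //.
have : \sum_i h (P q i) - r <= t by rewrite le_max lexx orbT.
by rewrite tz subr_le0.
Qed.

End Certificate.

(** * Hyperplane sections, projections to planes, and sign choices *)

Section Subspaces.
Variables (R : realType) (n : nat).
Implicit Types (K : set 'rV[R]_n) (u v x y : 'rV[R]_n) (r s m : R).

Lemma dotv_mulmx x y : x *m y^T = (dotv x y)%:M.
Proof.
apply/matrixP => i j; rewrite !ord1 !mxE eqxx mulr1n.
by apply: eq_bigr => k _; rewrite mxE.
Qed.

Lemma sub_kermx_dotv u x : (x <= kermx u^T)%MS <-> dotv x u = 0.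
Proof.
split=> [/sub_kermxP|xu]; last first.
  by apply/sub_kermxP; rewrite dotv_mulmx xu raddf0.
by rewrite dotv_mulmx => /matrixP /(_ 0 0); rewrite !mxE eqxx mulr1n.
Qed.

Lemma unit_neq0 u : dotv u u = 1 -> u != 0.
Proof.
by move=> u1; apply/eqP => u0; move/eqP: u1; rewrite u0 dot0v eq_sym oner_eq0.
Qed.

Lemma rank_orthogonal_hyperplane u : dotv u u = 1 -> \rank (kermx u^T) = n.-1.
Proof. by move=> /unit_neq0 u0; rewrite mxrank_ker mxrank_tr rank_rV u0 subn1. Qed.

Lemma exists_unit_orthogonal u : (2 <= n)%N -> dotv u u = 1 ->
  exists2 v, enorm v = 1 & dotv v u = 0.
Proof.
move=> n2 u1; have : kermx u^T != 0.
  rewrite -mxrank_eq0 rank_orthogonal_hyperplane // -lt0n.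
  by case: n n2 => [|[]].
case/rowV0Pn => v /sub_kermx_dotv vu v0.
exists ((enorm v)^-1 *: v); first exact: enorm_normalize.
by rewrite dotvZl vu mulr0.
Qed.

Lemma le_rin_hyperplane K u y r :
  (2 <= n)%N -> compact K -> 0 < rin n.-1 K -> dotv u u = 1 -> 0 <= r ->
  (forall x, dotv x u = dotv y u -> enorm (x - y) <= r -> K x) ->
  r <= rin n.-1 K.
Proof.
move=> n2 Kc rin0 u1 r0 Ky.
pose L := kermx u^T; pose m := dotv y u.
have affP x : affsp (m *: u) L x <-> dotv x u = m.
  split=> [[z /sub_kermx_dotv zu <-]|xu].
    by rewrite dotvDl dotvZl u1 mulr1 zu addr0.
  exists (x - m *: u); last by rewrite addrC subrK.
  by apply/sub_kermx_dotv; rewrite dotvBl dotvZl u1 mulr1 xu subrr.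
have [v v1 vu] := exists_unit_orthogonal n2 u1.
have [M KM] := compact_enorm_bounded Kc.
(* A supremum that does not exist has the default value 0, so positivity of [rin] supplies the
   boundedness of the outer supremum. *)
have hsup : has_sup [set s | exists L : 'M[R]_n, \rank L = n.-1 /\
    exists2 x, orthc L x & s = inradius (K `&` affsp x L) (affsp x L)].
  by apply: contrapT => /sup_out E; move: rin0; rewrite /rin E ltxx.
apply: (@le_trans _ _ (inradius (K `&` affsp (m *: u) L) (affsp (m *: u) L))).
  apply: ub_le_sup; last first.
    split=> //; exists y; first exact/affP.
    by move=> x [yx /affP xm]; split; [exact: Ky | exact/affP].
  (* A ball of radius [s] in the section contains both [c] and [c + s v], whose norms are at most
     [M]. *)
  exists (M + M) => s [s0 [c /affP cm cK]].
  have Kc' : K c.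
    apply: (proj1 (cK c _)); split; last exact/affP.
    by rewrite /eball /= subrr enorm0.
  have Kv : K (c + s *: v).
    apply: (proj1 (cK _ _)); split; last first.
      by apply/affP; rewrite dotvDl dotvZl vu mulr0 addr0.
    by rewrite /eball /= addrC addKr enormZ v1 mulr1 ger0_norm.
  have := dotv_le_enorm (- c) v; have := dotv_le_enorm (c + s *: v) v.
  have := KM _ Kc'; have := KM _ Kv; rewrite enormN v1 dotvNl dotvDl dotvZl.
  by move/enorm_unit: v1 => ->; lra.
apply: (ub_le_sup (proj2 hsup)); exists L; split.
  exact: rank_orthogonal_hyperplane.
exists (m *: u) => // z /sub_kermx_dotv zu.
by rewrite dotvZl dotvC zu mulr0.
Qed.

Lemma circumradius_ge0 (C A : set 'rV[R]_n) : 0 <= circumradius C A.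
Proof.
rewrite /circumradius; set E := (X in inf X).
(* The infimum of the empty set is 0 by default, so this case holds too. *)
have [E0|E0] := pselect (E !=set0); last by rewrite inf_out // => -[].
by apply: lb_le_inf => // s [].
Qed.

Lemma rank_orthonormal_pair u v :
  dotv u u = 1 -> dotv v v = 1 -> dotv u v = 0 -> \rank (u + v)%MS = 2.
Proof.
move=> u1 v1 uv; rewrite mxrank_disjoint_sum ?rank_rV ?unit_neq0 //.
apply/eqP/rowV0P => x; rewrite sub_capmx => /andP[/sub_rVP[a xa] /sub_rVP[b xb]].
by apply: dotvv_eq0; rewrite {1}xa xb dotvZl dotvZr uv !mulr0.
Qed.

(** The projection to the span of [u] and [v] lies in a square of half-side [s], hence in the disc
    of radius [sqrt 2 * s] about the centre of the square. *)
Lemma Rcirc2_le K u v (mu mv s : R) :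
  dotv u u = 1 -> dotv v v = 1 -> dotv u v = 0 -> 0 <= s ->
  (forall x, K x -> `|dotv x u - mu| <= s /\ `|dotv x v - mv| <= s) ->
  Rcirc 2 K <= Num.sqrt 2 * s.
Proof.
move=> u1 v1 uv s0 Ks; pose L := (u + v)%MS.
have s2 : 0 <= Num.sqrt 2 * s by rewrite mulr_ge0 ?sqrtr_ge0.
apply: (@le_trans _ _ (circumradius (oproj K L) (subsp L))).
  apply: ge_inf; first by exists 0 => _ [L' [_ ->]]; exact: circumradius_ge0.
  by exists L; split => //; exact: rank_orthonormal_pair.
have uL : subsp L u by exact: addsmxSl.
have vL : subsp L v by exact: addsmxSr.
apply: ge_inf; first by exists 0 => t [].
split=> //; exists (mu *: u + mv *: v).
  by apply: addmx_sub; apply: scalemx_sub.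
move=> p [x Kx [/sub_addsmxP[[a b] /= pE] xp]].
rewrite (mx11_scalar a) (mx11_scalar b) !mul_scalar_mx in pE.
(* Orthogonality of [x - p] to the plane identifies the coordinates of [p] with [x.u] and [x.v]. *)
have := xp _ uL; have := xp _ vL.
rewrite !dotvBl pE !dotvDl !dotvZl u1 v1 uv (dotvC v) uv.
rewrite !mulr0 !mulr1 addr0 add0r => /eqP; rewrite subr_eq0 => /eqP xv.
move=> /eqP; rewrite subr_eq0 => /eqP xu.
have [] := Ks _ Kx; rewrite xu xv /eball /= => hu hv.
have -> : a 0 0 *: u + b 0 0 *: v - (mu *: u + mv *: v) =
          (a 0 0 - mu) *: u + (b 0 0 - mv) *: v.
  by rewrite !scalerBl opprD addrACA.
rewrite enorm_le // exprMn sqr_sqrtr ?ler0n //.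
rewrite !(dotvDl, dotvDr) !(dotvZl, dotvZr) u1 v1 uv (dotvC v) uv.
move: hu hv; rewrite -!(ler_sqr (x := `|_|)) ?nnegrE // !real_normK ?num_real //.
move: (a 0 0 - mu) (b 0 0 - mv) => A B; lra.
Qed.

(** By induction: each new sign is chosen to make the cross term with the signed sum of the other
    vectors nonnegative. *)
Lemma exists_signs (k : nat) (p : 'I_k -> 'rV[R]_n) :
  exists2 e : 'I_k -> R, forall i, `|e i| = 1 &
    \sum_i dotv (p i) (p i) <= dotv (\sum_i e i *: p i) (\sum_i e i *: p i).
Proof.
elim: k p => [|k IH] p.
  by exists (fun=> 1) => [i|]; rewrite ?normr1 // !big_ord0 dot0v.
have [e e1 he] := IH (fun i => p (lift ord0 i)).
set S := \sum_i _ in he; set y := \sum_i _ in he.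
pose e0 : R := if 0 <= dotv (p ord0) y then 1 else -1.
have e01 : `|e0| = 1 by rewrite /e0; case: ifP; rewrite ?normrN1 ?normr1.
exists (fun i => if unlift ord0 i is Some j then e j else e0) => [i|].
  by case: unliftP.
rewrite !big_ord_recl unlift_none -/S.
have -> : \sum_(i < k) (if unlift ord0 (lift ord0 i) is Some j then e j else e0)
    *: p (lift ord0 i) = y by apply: eq_bigr => i _; rewrite liftK.
rewrite !(dotvDl, dotvDr) !(dotvZl, dotvZr) (dotvC y).
have ed : 0 <= e0 * dotv (p ord0) y.
  rewrite /e0; case: ifP => [|/negbT]; rewrite ?mul1r // mulN1r -ltNge.
  by rewrite oppr_ge0 => /ltW.
have : e0 * (e0 * dotv (p ord0) (p ord0)) = dotv (p ord0) (p ord0).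
  by rewrite mulrA -expr2 -[e0 ^+ 2]real_normK ?num_real // e01 expr1n mul1r.
lra.
Qed.

(** Sum the tangent line bound [a^2 >= 2 c a - c^2] at [c = 1 / k]. *)
Lemma sum_sqr_ge (k : nat) (a : 'I_k -> R) :
  (0 < k)%N -> \sum_i a i = 1 -> k%:R^-1 <= \sum_i a i ^+ 2.
Proof.
move=> k0 a1; set c := k%:R^-1.
have kc : k%:R * c = 1 by rewrite mulfV // pnatr_eq0 -lt0n.
have : \sum_i (2 * c * a i - c ^+ 2) <= \sum_i a i ^+ 2.
  by apply: ler_sum => i _; have := sqr_ge0 (a i - c); nra.
rewrite sumrB -mulr_sumr a1 sumr_const card_ord -[_ *+ k]mulr_natl expr2 mulrA kc.
lra.
Qed.

End Subspaces.

(** * Support function, minimal width, and sections of a convex body *)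

Definition support_fun (R : realType) (n : nat) (K : set 'rV[R]_n)
  (v : 'rV[R]_n) : R := sup [set dotv x v | x in K].

Section ConvexBody.
Variables (R : realType) (n : nat) (K : set 'rV[R]_n).
Hypothesis K_body : convex_body K.
Implicit Types (u v x y : 'rV[R]_n) (t : R).
Local Notation h := (support_fun K).

Let K_neq0 : K !=set0. Proof. by case: K_body. Qed.
Let K_compact : compact K. Proof. by case: K_body => _ []. Qed.
Let K_convex : Defs.convex_set K. Proof. by case: K_body => _ []. Qed.

Lemma support_fun_ge x v : K x -> dotv x v <= h v.
Proof.
move=> Kx; apply: ub_le_sup; last by exists x.
have [M KM] := compact_enorm_bounded K_compact.
exists (M * enorm v) => _ [y Ky <-]; apply: (le_trans (dotv_le_enorm _ _)).
by rewrite ler_wpM2r ?enorm_ge0 ?KM.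
Qed.

Lemma support_fun_le v t : (forall x, K x -> dotv x v <= t) -> h v <= t.
Proof.
move=> Kt; apply: ge_sup; last by move=> _ [x Kx <-]; exact: Kt.
by have [x Kx] := K_neq0; exists (dotv x v), x.
Qed.

Lemma support_fun_attained v : exists2 x, K x & h v <= dotv x v.
Proof.
have [|x Kx xmin] := @compact_min _ _ (fun x => - dotv x v) _ K_neq0 K_compact.
  move=> x; apply: (@continuousN _ _ _ (fun y => dotv y v)).
  apply: (@continuous_dotv _ _ _ id (cst v)) => s; first exact: cvg_id.
  exact: cst_continuous.
by exists x => //; apply: support_fun_le => s /xmin; rewrite lerN2.
Qed.

Lemma support_fun_scale t v : 0 <= t -> h (t *: v) <= t * h v.
Proof.
move=> t0; apply: support_fun_le => x Kx.
by rewrite dotvZr ler_wpM2l // support_fun_ge.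
Qed.

(** A bound [M] on the norms of points of [K] is a Lipschitz constant for [h]. *)
Lemma support_fun_continuous : continuous h.
Proof.
have [M KM] := compact_enorm_bounded K_compact.
have lip v w : h v <= h w + M * enorm (v - w).
  apply: support_fun_le => x Kx.
  have -> : dotv x v = dotv x w + dotv x (v - w) by rewrite dotvBr addrC subrK.
  apply: lerD; first exact: support_fun_ge.
  apply: (le_trans (dotv_le_enorm _ _)).
  by rewrite ler_wpM2r ?enorm_ge0 ?KM.
move=> v.
have ec : M * enorm (w - v) @[w --> v] --> (0 : R).
  have c : {for v, continuous (cst M \* (fun w => enorm (w - v)))}.
    apply: continuousM; first exact: cst_continuous.
    apply: (@continuous_comp 'rV[R]_n 'rV[R]_n R (fun w => w - v) (@enorm R n) v).
      apply: (@continuousB _ _ _ id (cst v) v); first exact: cvg_id.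
      exact: cst_continuous.
    exact: continuous_enorm.
  suff <- : (cst M \* (fun w => enorm (w - v))) v = 0 by exact: c.
  by rewrite /= subrr enorm0 mulr0.
apply: (@squeeze_cvgr _ (nbhs v) _ _ (fun w => h v - M * enorm (w - v))
  (fun w => h v + M * enorm (w - v))).
- apply: nearW => w; rewrite lip andbT lerBlDr.
  by rewrite -[enorm _]enormN opprB lip.
- by rewrite -[X in _ --> X]subr0; apply: cvgB => //; exact: cvg_cst.
- by rewrite -[X in _ --> X]addr0; apply: cvgD => //; exact: cvg_cst.
Qed.

Lemma min_width_direction : (0 < n)%N ->
  exists2 u, enorm u = 1 &
    forall v, enorm v = 1 -> h u + h (- u) <= h v + h (- v).
Proof.
move=> n0; pose S := [set u : 'rV[R]_n | enorm u = 1].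
apply: (@compact_min _ _ (fun u => h u + h (- u)) S).
- pose e := delta_mx 0 (Ordinal n0) : 'rV[R]_n.
  have e0 : e != 0.
    apply/eqP => /rowP /(_ (Ordinal n0)); rewrite !mxE !eqxx => /eqP.
    by rewrite oner_eq0.
  by exists ((enorm e)^-1 *: e); exact: enorm_normalize.
- apply: compact_box => [|u u1 i].
    by apply: closed_eq_cst; exact: continuous_enorm.
  by rewrite -[leRHS]u1 coord_le_enorm.
- move=> u; apply: (@continuousD _ _ _ h (fun u => h (- u))).
    exact: support_fun_continuous.
  apply: (@continuous_comp 'rV[R]_n 'rV[R]_n R -%R h u); last exact: support_fun_continuous.
  exact: opp_continuous.
Qed.

(* The difference body [K - K] has support function at least the minimal width
   [w] on the unit sphere, so it contains [w u]. *)
Lemma min_width_chord u w : enorm u = 1 -> 0 <= w ->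
  (forall v, enorm v = 1 -> w <= h v + h (- v)) ->
  exists a b, [/\ K a, K b & b - a = w *: u].
Proof.
move=> u1 w0 wmin.
pose D := [set p.1 - p.2 | p in K `*` K].
suff [[b a] [/= Kb Ka] E] : D (w *: u) by exists a, b.
apply: contrapT => /(@strict_separation R n D).
have [x Kx] := K_neq0; case.
- by exists (x - x), (x, x).
- apply: continuous_compact; last exact: compact_setX.
  by apply: continuous_subspaceT => p; exact: sub_continuous.
- move=> _ _ [[a b] [/= Ka Kb] <-] [[c d] [/= Kc Kd] <-] t t01.
  exists (t *: a + (1 - t) *: c, t *: b + (1 - t) *: d) => /=.
    by split; apply: K_convex.
  by rewrite !scalerBr opprD addrACA.
move=> z [z1 [zs _]]; have := wmin z z1; apply/negP; rewrite -ltNge.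
(* The value [h z + h (- z)] is reached by a difference of points of [K], so separation puts it
   strictly below [w u.z], which is at most [w]. *)
apply: (@lt_le_trans _ _ (dotv (w *: u) z)); last first.
  rewrite dotvZl ler_piMr //; apply: (le_trans (dotv_le_enorm _ _)).
  by rewrite u1 z1 mulr1.
have [y Ky yh] := support_fun_attained z.
have [y' Ky' yh'] := support_fun_attained (- z).
have := zs (y - y'); rewrite dotvBl => H.
have : D (y - y') by exists (y, y').
by move=> /H; move: yh' yh; rewrite dotvNr; lra.
Qed.

(** Otherwise separate [y] from the projection of [K]. The normal joins two points of the
    hyperplane, so it is orthogonal to [u] and the bound on [h] applies to it; this contradicts
    [y.z <= r + c.z]. *)
Lemma projection_contains_ball u c (r : R) y : dotv u u = 1 ->
  (forall v, enorm v = 1 -> dotv v u = 0 -> r + dotv c v <= h v) ->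
  dotv y u = 0 -> dotv c u = 0 -> enorm (y - c) <= r ->
  exists2 x, K x & x - dotv x u *: u = y.
Proof.
move=> u1 hr yu cu ycr.
pose f x := x - dotv x u *: u.
have fu x : dotv (f x) u = 0 by rewrite dotvBl dotvZl u1 mulr1 subrr.
suff [x Kx E] : [set f x | x in K] y by exists x.
apply: contrapT => /(@strict_separation R n [set f x | x in K]); case.
- by have [x Kx] := K_neq0; exists (f x), x.
- apply: continuous_compact => //; apply: continuous_subspaceT.
  apply: continuous_mx => i j.
  have -> : (fun x => f x i j) = (fun x => x i j - dotv x u * u i j).
    by apply/funext => x; rewrite !mxE.
  move=> x; apply: (@continuousB _ _ _ (fun x => x i j)).
    exact: coord_continuous.
  apply: (@continuousM R 'rV[R]_n (fun x => dotv x u) (cst (u i j)) x); last exact: cst_continuous.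
  apply: (@continuous_dotv _ _ _ id (cst u)) => s; first exact: cvg_id.
  exact: cst_continuous.
- move=> _ _ [a Ka <-] [b Kb <-] t t01.
  exists (t *: a + (1 - t) *: b); first exact: K_convex.
  by rewrite /f dotvDl !dotvZl; apply/rowP => i; rewrite !mxE; ring.
move=> z [z1 [zs [_ [p Kp <-] zE]]].
have zu : dotv z u = 0 by rewrite zE dotvZl dotvBl yu fu subrr mulr0.
have yz : dotv y z <= r + dotv c z.
  rewrite -lerBlDr -dotvBl; apply: (le_trans (dotv_le_enorm _ _)).
  by rewrite z1 mulr1.
have [x Kx xh] := support_fun_attained z.
have := zs (f x); rewrite dotvBl dotvZl (dotvC u) zu mulr0 subr0.
have : [set f x | x in K] (f x) by exists x.
move=> Kfx /(_ Kfx); have := hr z z1 zu; lra.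
Qed.

(* Halving towards the chord [a, b], which spans the whole slab, brings the lift
   of a ball of the projection to the middle level of the slab. *)
Lemma middle_section_ball u a b c (w r : R) :
  (2 <= n)%N -> 0 < rin n.-1 K -> dotv u u = 1 -> 0 <= r ->
  K a -> K b -> b - a = w *: u ->
  (forall x, K x -> dotv a u <= dotv x u <= dotv b u) ->
  (forall v, enorm v = 1 -> dotv v u = 0 -> r + dotv c v <= h v) ->
  r / 2 <= rin n.-1 K.
Proof.
move=> n2 rin0 u1 r0 Ka Kb ab slab hr.
pose m := (dotv a u + dotv b u) / 2.
pose c' := c - dotv c u *: u; pose a' := a - dotv a u *: u.
have c'u : dotv c' u = 0 by rewrite dotvBl dotvZl u1 mulr1 subrr.
have a'u : dotv a' u = 0 by rewrite dotvBl dotvZl u1 mulr1 subrr.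
have hr' v : enorm v = 1 -> dotv v u = 0 -> r + dotv c' v <= h v.
  move=> v1 vu; rewrite dotvBl dotvZl (dotvC u) vu mulr0 subr0; exact: hr.
pose y := 2^-1 *: (c' + a') + m *: u.
have yu : dotv y u = m.
  by rewrite dotvDl !dotvZl dotvDl c'u a'u u1 addr0 mulr0 add0r mulr1.
apply: (@le_rin_hyperplane R n K u y) => //; first lra.
move=> x; rewrite yu => xu xy.
(* Chosen so that the part of [x] orthogonal to [u] is the midpoint of [z'] and [a']. *)
pose z' := 2 *: (x - m *: u) - a'.
have [|||z Kz zE] := @projection_contains_ball u c' r z' u1 hr' => //.
- by rewrite dotvBl dotvZl dotvBl dotvZl xu u1 a'u mulr1 !subrr mulr0 subr0.
- have -> : z' - c' = 2 *: (x - y).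
    by apply/rowP => i; rewrite !mxE; field.
  by rewrite enormZ ger0_norm //; lra.
(* With this height on the chord, the midpoint of [z] and [a + s u] has level [m]. *)
pose s := dotv b u - dotv z u.
have wE : w = dotv b u - dotv a u by rewrite -dotvBl ab dotvZl u1 mulr1.
have /andP[az zb] := slab _ Kz.
have Ks : K (a + s *: u).
  (* For [w = 0] the slab is a single hyperplane and the chord a single point. *)
  have [w0|w0] := eqVneq w 0.
    have -> : s = 0 by rewrite /s; lra.
    by rewrite scale0r addr0.
  have wp : 0 < w by rewrite lt0r w0 wE; lra.
  have -> : a + s *: u = (s / w) *: b + (1 - s / w) *: a.
    have -> : b = a + w *: u by rewrite -ab addrC subrK.
    by apply/rowP => i; rewrite !mxE; field.
  apply: K_convex => //; rewrite divr_ge0 ?(ltW wp) //; last by rewrite /s; lra.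
  by rewrite ler_pdivrMr // /s; lra.
have -> : x = 2^-1 *: z + (1 - 2^-1) *: (a + s *: u).
  have -> : z = z' + dotv z u *: u by rewrite -zE subrK.
  by apply/rowP => i; rewrite /s /z' /a' /m !mxE; field.
by apply: K_convex => //; lra.
Qed.

(** The signed sum [v] of balanced vectors has squared length at least [1 / n], while [K] has width
    at most [2 r] when measured against [v]; normalising costs a factor [sqrt n]. *)
Lemma short_orthogonal_direction u (r : R) :
  (0 < n)%N -> dotv u u = 1 ->
  (forall c, exists v,
      [/\ enorm v = 1, dotv v u = 0 & h v < r + dotv c v]) ->
  exists v, [/\ enorm v = 1, dotv v u = 0 &
    h v + h (- v) <= 2 * (Num.sqrt n%:R * r)].
Proof.
move=> n0 u1 hr.
have [p [pu p0 p1 ph]] :=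
  balanced_directions support_fun_continuous support_fun_scale u1 hr.
have [e e1 he] := exists_signs p.
set v := \sum_i e i *: p i in he.
have vn : n%:R^-1 <= dotv v v.
  apply: (le_trans (sum_sqr_ge n0 p1)); apply: le_trans he.
  by apply: ler_sum => i _; rewrite enorm_sqr.
have n0' : 0 < n%:R :> R by rewrite ltr0n.
have vp : 0 < enorm v.
  by rewrite sqrtr_gt0 (lt_le_trans _ vn) // invr_gt0.
have vinv : (enorm v)^-1 <= Num.sqrt n%:R.
  rewrite -[leRHS]invrK lef_pV2 ?posrE ?invr_gt0 ?(sqrtr_gt0 n%:R) //.
  by rewrite -sqrtrV ?ler0n // ler_wsqrtr.
(* For any [x] in [K], [0 = sum x.p_i <= sum h(p_i) <= r]. *)
have r0 : 0 <= r.
  apply: le_trans ph; have [x Kx] := K_neq0.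
  apply: (@le_trans _ _ (\sum_i dotv x (p i))).
    by rewrite -dotv_sumr p0 dotv0.
  by apply: ler_sum => i _; exact: support_fun_ge.
(* Since [x.v - mid] is the signed sum of the gaps [h(p_i) - x.p_i] up to sign, it is bounded by
   their total, which is [sum h(p_i)] because [sum p_i = 0]. *)
pose mid := \sum_i e i * h (p i).
have slab x : K x -> `|dotv x v - mid| <= r.
  move=> Kx; rewrite distrC dotv_sumr -sumrB; apply: le_trans ph.
  apply: (le_trans (ler_norm_sum _ _ _)).
  have -> : \sum_i h (p i) = \sum_i (h (p i) - dotv x (p i)).
    by rewrite sumrB -dotv_sumr p0 dotv0 subr0.
  apply: ler_sum => i _; rewrite dotvZr -mulrBr normrM e1 mul1r ger0_norm //.
  by rewrite subr_ge0 support_fun_ge.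
exists ((enorm v)^-1 *: v); split.
- by apply: enorm_normalize; apply: contraTneq vp => ->; rewrite enorm0 ltxx.
- rewrite dotvZl dotvC dotv_sumr big1 ?mulr0 // => i _.
  by rewrite dotvZr dotvC pu mulr0.
have hv : h v <= mid + r.
  by apply: support_fun_le => x /slab; rewrite ler_distl; lra.
have hNv : h (- v) <= r - mid.
  by apply: support_fun_le => x /slab; rewrite dotvNr ler_distl; lra.
have vi0 : 0 <= (enorm v)^-1 by rewrite invr_ge0 enorm_ge0.
have h1 := support_fun_scale v vi0.
have h2 := support_fun_scale (- v) vi0.
rewrite scalerN in h2.
apply: (le_trans (lerD h1 h2)); rewrite -mulrDr.
apply: (@le_trans _ _ ((enorm v)^-1 * (2 * r))).
  by rewrite ler_wpM2l //; lra.
by rewrite mulrCA ler_wpM2l ?ler0n // ler_wpM2r.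
Qed.

End ConvexBody.

Theorem theorem1p3 (R : realType) (n : nat) (K : set 'rV[R]_n) :
  (2 <= n)%N -> convex_body K -> 0 < rin n.-1 K ->
  Rcirc 2 K / rin n.-1 K <= 2 * Num.sqrt 2 * Num.sqrt (n%:R).
Proof.
move=> n2 Kb rin0; have n0 : (0 < n)%N by exact: leq_trans n2.
set h := support_fun K.
have [u u1 umin] := min_width_direction Kb n0.
have uu : dotv u u = 1 by apply/enorm_unit.
have w0 : 0 <= h u + h (- u).
  have [[x Kx] _] := Kb.
  have := support_fun_ge Kb u Kx; have := support_fun_ge Kb (- u) Kx.
  by rewrite dotvNr -/h; lra.
have [a [b [Ka Kb' ab]]] := min_width_chord Kb u1 w0 umin.
(* The chord is as long as the width in direction [u], so its ends lie on the two supporting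
   hyperplanes normal to [u]. *)
have slab x : K x -> dotv a u <= dotv x u <= dotv b u.
  move=> Kx; have := congr1 (fun z => dotv z u) ab; rewrite /= dotvBl dotvZl uu mulr1.
  have := support_fun_ge Kb u Kx; have := support_fun_ge Kb (- u) Kx.
  have := support_fun_ge Kb u Kb'; have := support_fun_ge Kb (- u) Ka.
  by rewrite !dotvNr -/h; lra.
have sn : 0 < Num.sqrt n%:R :> R by rewrite sqrtr_gt0 ltr0n.
have s2 : 0 < Num.sqrt 2 :> R by rewrite sqrtr_gt0 ltr0n.
rewrite ler_pdivrMr //.
have -> : 2 * Num.sqrt 2 * Num.sqrt n%:R * rin n.-1 K =
  2 * rin n.-1 K * (Num.sqrt 2 * Num.sqrt n%:R) by ring.
rewrite -ler_pdivrMr ?mulr_gt0 //.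
(* It suffices to treat every [r > 2 r_{n-1}(K)]; the strict inequality excludes a ball of radius
   [r / 2] in a section. *)
apply/unstable.ler_gtP => r rr; rewrite ler_pdivrMr ?mulr_gt0 //.
have r0 : 0 <= r by lra.
have hr c : exists v, [/\ enorm v = 1, dotv v u = 0 & h v < r + dotv c v].
  apply: contrapT => nv.
  suff : r / 2 <= rin n.-1 K by lra.
  apply: (middle_section_ball Kb n2 rin0 uu r0 Ka Kb' ab slab (c := c)) => v v1 vu.
  by rewrite leNgt; apply/negP => hv; apply: nv; exists v.
have [v [v1 vu vw]] := short_orthogonal_direction Kb n0 uu hr.
have vv : dotv v v = 1 by apply/enorm_unit.
(* The values [x.z] fill a range within [[- h(-z), h(z)]], whose midpoint is the centre used
   here. *)
have half z x : K x -> h z + h (- z) <= 2 * (Num.sqrt n%:R * r) ->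
    `|dotv x z - (h z - h (- z)) / 2| <= Num.sqrt n%:R * r.
  move=> Kx hz; rewrite ler_distl.
  have := support_fun_ge Kb z Kx; have := support_fun_ge Kb (- z) Kx.
  by rewrite dotvNr -/h; move: hz; move: (Num.sqrt _ * r) => s; lra.
rewrite mulrC -mulrA; apply: (@Rcirc2_le R n K u v ((h u - h (- u)) / 2)
  ((h v - h (- v)) / 2)) => //; [by rewrite dotvC|by rewrite mulr_ge0 // ltW|].
move=> x Kx; split; apply: half => //.
(* Minimality of the width in direction [u] transfers the bound from [v] to [u]. *)
exact: le_trans (umin _ v1) vw.
Qed.
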